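(* A characteristic Sturmian word $s=\psi(v)$ is stable if and only if its directive word $v$ is ultimately periodic.
   Context: Palindromization map on finite words: $\psi(\varepsilon)=\varepsilon$, $\psi(uz)=(\psi(u)z)^{(+)}$ ($z$ a letter, $t^{(+)}$ the shortest palindrome with prefix $t$); for infinite $v\in\{a,b\}^\omega$, $\psi(v)=\lim_n\psi(v_{[n]})$, $v_{[n]}$ the length-$n$ prefix. Characteristic Sturmian words are the words $\psi(v)$ with $v$ containing both letters infinitely often; $v$ is the (unique) directive word. Writing $v=x_0^{\alpha_0}x_1^{\alpha_1}\cdots$ ($\alpha_i\ge1$, $x_{i+1}\ne x_i$), the index of $s=\psi(v)$ is $k=\alpha_0$. Let $\mu_k:a\mapsto a^kba,\ b\mapsto a^kb$ and $\hat\mu_k:a\mapsto b^ka,\ b\mapsto b^kab$; $s$ factors uniquely over $\{a^kb,a^kba\}$ (if $s$ begins with $a$) or over $\{b^ka,b^kab\}$ (if it begins with $b$), and $Ds=\mu_k^{-1}(s)$, resp. $\hat\mu_k^{-1}(s)$; $Ds$ is again a characteristic Sturmian word. $D^0s=s$, $D^ps=D(D^{p-1}s)$. $s$ is stable if $D^ms=D^ns$ for some $m\neq n\ge0$. An infinite word is ultimately periodic if it equals $uz^\omega$ with $u$ finite and $z$ nonempty finite. *)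

(* Defs.v *)
From mathcomp Require Import all_boot.
From mathcomp Require Import boolp classical_sets.

Set Implicit Arguments.
Unset Strict Implicit.
Unset Printing Implicit Defensive.

Local Open Scope classical_set_scope.

(* The alphabet {a, b} is bool.
   [get A] is the element of A when A is a singleton, which is the case of
   every set to which [get] or [xget] is applied below when s is a
   characteristic Sturmian word. *)
Notation letter := bool.
Definition La : letter := false.
Definition Lb : letter := true.

Definition infword := nat -> letter.

Definition iprefix (v : infword) (n : nat) : seq letter := mkseq v n.

Definition palindrome (w : seq letter) : bool := rev w == w.

Definition shortest_palindrome (t p : seq letter) : Prop :=
  [/\ palindrome p, prefix t p &
      forall q : seq letter, palindrome q -> prefix t q -> size p <= size q].

(* t^(+) *)
Definition pal_closure (t : seq letter) : seq letter :=
  xget [::] [set p | shortest_palindrome t p].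

(* psi(empty) = empty and psi(uz) = (psi(u) z)^(+) *)
Definition psi (w : seq letter) : seq letter :=
  foldl (fun p z => pal_closure (rcons p z)) [::] w.

(* Every prefix of s is a prefix of all but finitely many of the w n. *)
Definition is_word_limit (w : nat -> seq letter) (s : infword) : Prop :=
  forall l : nat, exists N : nat,
    forall n : nat, N <= n -> prefix (iprefix s l) (w n).

Definition word_lim (w : nat -> seq letter) : infword :=
  get [set s | is_word_limit w s].

Definition psi_inf (v : infword) : infword :=
  word_lim (fun n => psi (iprefix v n)).

Definition infinitely_often (v : infword) (c : letter) : Prop :=
  forall n : nat, exists2 m : nat, n <= m & v m = c.

(* s is the characteristic Sturmian word with directive word v. *)
Definition directive_word (s v : infword) : Prop :=
  [/\ infinitely_often v La, infinitely_often v Lb & s = psi_inf v].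

(* k = alpha_0 in the factorization v = x_0^alpha_0 x_1^alpha_1 ... *)
Definition first_run (v : infword) (k : nat) : Prop :=
  (forall i : nat, i < k -> v i = v 0) /\ v k <> v 0.

Definition sturm_index (s : infword) : nat :=
  xget 0 [set k | exists2 v : infword, directive_word s v & first_run v k].

(* Image of an infinite word under the morphism extending f. *)
Definition morph_inf (f : letter -> seq letter) (t : infword) : infword :=
  word_lim (fun n => flatten [seq f c | c <- iprefix t n]).

Definition mu (k : nat) (c : letter) : seq letter :=
  if c == La then nseq k La ++ [:: Lb; La] else nseq k La ++ [:: Lb].

Definition mu_hat (k : nat) (c : letter) : seq letter :=
  if c == La then nseq k Lb ++ [:: La] else nseq k Lb ++ [:: La; Lb].

Definition D (s : infword) : infword :=
  let k := sturm_index s in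
  let f := if s 0 == La then mu k else mu_hat k in
  get [set t : infword | morph_inf f t = s].

Definition stable (s : infword) : Prop :=
  exists m n : nat, m <> n /\ iter m D s = iter n D s.

Definition omega_power (z : seq letter) : infword :=
  fun n => nth La z (n %% size z).

Definition inf_cat (u : seq letter) (w : infword) : infword :=
  fun n => if n < size u then nth La u n else w (n - size u).

Definition ultimately_periodic (v : infword) : Prop :=
  exists u z : seq letter, z <> [::] /\ v = inf_cat u (omega_power z).

(* Main.v *)
Require Import Defs.
From mathcomp Require Import all_boot.
From mathcomp Require Import boolp classical_sets.

Set Implicit Arguments.
Unset Strict Implicit.
Unset Printing Implicit Defensive.

(** Write E(x,k) (here [elem x k]) for the morphism sending x to x^k y x and y
    to x^k y, where y is the letter other than x, so that mu_k = E(a,k)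
    and hat mu_k = E(b,k). Justin's formula psi(y w) = E(x,0)(psi w) y,
    iterated, gives psi(x^k y v) = E(x,k)(psi v) for infinite v. In the
    image of t under E(x,k) the letter at position 2k+1 is the first
    letter of t, so E(x,k) is injective on infinite words; hence psi is
    injective too, and D(psi v) is psi of v with its first run and the
    letter after it removed. Thus the iterates of D on s = psi v are psi
    of tails of v starting at strictly increasing positions, and two of
    them coincide iff two such tails do. *)

(** * Palindromic closure *)

Lemma palindrome_cons_rcons c d w :
  palindrome (c :: rcons w d) = (c == d) && palindrome w.
Proof.
by rewrite /palindrome rev_cons rev_rcons rcons_cons eqseq_cons eqseq_rcons
           andbC -andbA [d == c]eq_sym andbb andbC.
Qed.

(** A palindrome properly extending [c :: t'] also ends in [c], and stripping both ends leaves a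
    palindrome with prefix [t']; so this recursion computes the palindromic closure. *)
Fixpoint pal_ext (t : seq letter) : seq letter :=
  if t is c :: t' then
    if palindrome t then t else c :: rcons (pal_ext t') c
  else [::].

Lemma palindrome_pal_ext t : palindrome (pal_ext t).
Proof.
elim: t => [|c t IH] //=; case: ifP => // _.
by rewrite palindrome_cons_rcons eqxx.
Qed.

Lemma prefix_pal_ext t : prefix t (pal_ext t).
Proof.
elim: t => [|c t IH] //=; case: ifP => _; first exact: prefix_refl.
by rewrite prefix_cons eqxx (prefix_trans IH (prefix_rcons _ _)).
Qed.

(** The second conjunct makes the shortest palindrome unique, which determines the value of [xget]
    in [pal_closure]. *)
Lemma pal_ext_min t q : palindrome q -> prefix t q ->
  size (pal_ext t) <= size q /\ (size q <= size (pal_ext t) -> q = pal_ext t).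
Proof.
elim: t q => [|c t IH] q pq; first by case: q pq.
case/prefixP=> r qE /=; case: ifPn => [_|npt].
  rewrite qE size_cat; split; first exact: leq_addr.
  by case: r {qE} => [|e r]; rewrite ?cats0 //= addnS ltnNge leq_addr.
case: (lastP r) qE => [|r' d] qE; first by rewrite qE cats0 (negPf npt) in pq.
move: pq; rewrite qE /= -rcons_cat palindrome_cons_rcons.
case/andP=> /eqP <- pq'.
have [le_sz eq_sz] := IH _ pq' (prefix_prefix _ _).
by rewrite !size_rcons !ltnS; split=> // /eq_sz ->.
Qed.

Lemma pal_closureE t : pal_closure t = pal_ext t.
Proof.
apply: xget_unique.
  split; [exact: palindrome_pal_ext | exact: prefix_pal_ext |].
  by move=> q pq tq; have [] := pal_ext_min pq tq.
move=> q [pq tq minq]; have [_] := pal_ext_min pq tq; apply.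
exact: minq (palindrome_pal_ext t) (prefix_pal_ext t).
Qed.

(** * Justin's formula *)

(* The word E(~~x,0)(t) x. *)
Fixpoint justin (x : letter) (t : seq letter) : seq letter :=
  if t is c :: t' then
    if c == x then x :: justin x t' else x :: c :: justin x t'
  else [:: x].

Lemma justin_rcons x t c : justin x (rcons t c) =
  if c == x then rcons (justin x t) x else rcons (rcons (justin x t) c) x.
Proof.
elim: t => [|d t IH] /=; first by case: eqP.
by rewrite IH; do 2![case: ifP => _].
Qed.

Lemma rev_justin x t : rev (justin x t) = justin x (rev t).
Proof.
elim: t => [|c t IH] //; rewrite rev_cons justin_rcons /= -IH.
by case: ifP => _; rewrite !rev_cons.
Qed.

(** Since [justin x t] always begins with [x], the second letter of [justin x (c :: t)] is [c]; the
    empty word is told apart by length. *)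
Lemma justin_inj x : injective (justin x).
Proof.
have head t : head x (justin x t) = x by case: t => //= c t; case: ifP.
elim=> [|c t IH] [|d t'] //=; do ?[case: eqP => // ?].
- by case=> /(congr1 size) /=; case: t' => //= e t'; case: ifP.
- by case=> /(congr1 size) /=; case: t {IH} => //= e t; case: ifP.
- by case=> /IH ->; subst.
- by case=> /(congr1 (fun w => seq.head x w)) /=; rewrite head => ?; subst.
- by case=> /(congr1 (fun w => seq.head x w)) /=; rewrite head => ?; subst.
- by case=> -> /IH ->.
Qed.

Lemma palindrome_justin x t : palindrome (justin x t) = palindrome t.
Proof. by rewrite /palindrome rev_justin (inj_eq (@justin_inj x)). Qed.

Lemma last_justin x t e : last e (justin x t) = x.
Proof. by elim: t e => [|c t IH] e //=; case: ifP => /=. Qed.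

(** As [justin x] preserves and reflects palindromes, both recursions stop together; a letter [c]
    other than [x] costs two peelings on the left, of [x] and of [c], for one on the right. *)
Lemma pal_ext_justin x t z :
  pal_ext (rcons (justin x t) z) = justin x (pal_ext (rcons t z)).
Proof.
elim: t => [|c t IH] /=; first by case: x; case: z.
have [->|cx] := eqVneq c x.
  rewrite rcons_cons /= !palindrome_cons_rcons palindrome_justin.
  case: ifP => [/andP[/eqP <- _]|_]; first by rewrite /= eqxx justin_rcons eqxx.
  by rewrite IH /= eqxx justin_rcons eqxx.
rewrite !rcons_cons /= -rcons_cons !palindrome_cons_rcons.
have [zx|zx] := eqVneq z x.
  subst z; have npc : palindrome (c :: justin x t) = false.
    have [w ->] : exists w, justin x t = rcons w x.
      case/lastP: (justin x t) (last_justin x t c) => [/= E|w d].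
        by rewrite E eqxx in cx.
      by rewrite last_rcons => ->; exists w.
    by rewrite palindrome_cons_rcons (negPf cx).
  by rewrite npc andbF IH (negPf cx) /= (negPf cx) justin_rcons (negPf cx).
have zc : z = c by move: cx zx; case: (z); case: (c); case: (x).
subst z; rewrite eqxx /= palindrome_justin IH.
by case: ifP => _ /=; rewrite (negPf cx) justin_rcons (negPf cx).
Qed.

Lemma psi_rcons w z : psi (rcons w z) = pal_ext (rcons (psi w) z).
Proof. by rewrite /psi -cats1 foldl_cat /= pal_closureE. Qed.

Lemma psi_cons x w : psi (x :: w) = justin x (psi w).
Proof.
elim/last_ind: w => [|w z IH].
  by rewrite /psi /= pal_closureE; case: x.
by rewrite -rcons_cons !psi_rcons IH pal_ext_justin.
Qed.

(** * The morphisms E(x,k) on finite words *)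

Definition elem (x : letter) (k : nat) (c : letter) : seq letter :=
  nseq k x ++ ~~ x :: nseq (c == x) x.

Definition subst_word (f : letter -> seq letter) (t : seq letter) : seq letter :=
  flatten [seq f c | c <- t].

Lemma subst_word_cat f t u : subst_word f (t ++ u) = subst_word f t ++ subst_word f u.
Proof. by rewrite /subst_word map_cat flatten_cat. Qed.

Lemma justinE x t : justin x t = rcons (subst_word (elem (~~ x) 0) t) x.
Proof.
elim: t => [|c t IH] //=; rewrite IH -rcons_cons /subst_word /=.
by rewrite /elem; case: x {IH}; case: c.
Qed.

Lemma justin_cat x t u :
  justin x (t ++ u) = subst_word (elem (~~ x) 0) t ++ justin x u.
Proof. by rewrite !justinE subst_word_cat rcons_cat. Qed.

(** The morphism [elem (~~ x) 0] fixes [x] and puts an [x] before each [~~ x], so it lengthens the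
    leading run of every block by one. *)
Lemma subst_word_elemS x k t :
  subst_word (elem (~~ x) 0) (subst_word (elem x k) t) = subst_word (elem x k.+1) t.
Proof.
elim: t => [|c t IH] //; rewrite [in LHS]/subst_word /= -/(subst_word _ _).
rewrite -/(subst_word _ t) subst_word_cat IH; congr (_ ++ _).
have -> : elem x k.+1 c = nseq k x ++ [:: x, ~~ x & nseq (c == x) x].
  by rewrite /elem -(addn1 k) nseqD -catA.
rewrite {IH} [elem x k c]/elem subst_word_cat; congr (_ ++ _).
  by elim: k => //= k {2}<-; case: (x).
by case: c; case: x.
Qed.

(** The remainder [r] collects the letters that Justin's formula adds at the right end; they
    disappear in the limit. *)
Lemma psi_run x k w : exists r,
  psi (nseq k x ++ ~~ x :: w) = subst_word (elem x k) (psi w) ++ r.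
Proof.
elim: k => [|k [r IH]].
  by exists [:: ~~ x]; rewrite psi_cons justinE negbK cats1.
exists (justin x r).
by rewrite /= psi_cons IH justin_cat subst_word_elemS.
Qed.

(** * Infinite words *)

Definition shift (p : nat) (v : infword) : infword := fun n => v (p + n).

Lemma iprefixD v p n : iprefix v (p + n) = iprefix v p ++ iprefix (shift p v) n.
Proof.
by rewrite /iprefix /mkseq iotaD map_cat -[X in iota X n]addn0 iotaDl -map_comp.
Qed.

(** The bound on sizes ensures that every position is eventually filled, so that the limit exists
    and is unique. *)
Definition growing (w : nat -> seq letter) : Prop :=
  forall n, prefix (w n) (w n.+1) /\ n <= size (w n).

Lemma growing_nth w n m i : growing w -> i < size (w n) -> i < size (w m) ->
  nth La (w n) i = nth La (w m) i.
Proof.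
move=> gw; wlog le_nm : n m / n <= m => [H|].
  by case: (leqP n m) => [|/ltnW] le *; [|symmetry]; apply: H.
suff /prefixP[r ->] : prefix (w n) (w m) by move=> lin _; rewrite nth_cat lin.
elim: m le_nm => [|m IH]; first by rewrite leqn0 => /eqP ->; apply: prefix_refl.
rewrite leq_eqVlt => /predU1P[->|]; first exact: prefix_refl.
by move/IH/prefix_trans; apply; have [] := gw m.
Qed.

Lemma word_lim_nth w n i : growing w -> i < size (w n) ->
  word_lim w i = nth La (w n) i.
Proof.
move=> gw lin; pose s : infword := fun j => nth La (w j.+1) j.
have sz m : m <= size (w m) by have [] := gw m.
have sE m j : j < size (w m) -> s j = nth La (w m) j.
  by move=> ljm; apply: growing_nth.
suff -> : word_lim w = s by apply: sE.
have lim_s : is_word_limit w s.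
  move=> l; exists l => m le_lm; have le_lz := leq_trans le_lm (sz m).
  rewrite prefixE size_mkseq; apply/eqP/(@eq_from_nth _ La).
    by rewrite size_takel ?size_mkseq.
  rewrite size_takel // => j ltj; rewrite nth_take // nth_mkseq //.
  by rewrite (sE m) // (leq_trans ltj).
apply: get_unique => // t lim_t; apply/funext => j.
have [N HN] := lim_t j.+1; have [N' HN'] := lim_s j.+1.
move: (HN _ (leq_maxl N N')) (HN' _ (leq_maxr N N')).
rewrite !prefixE !size_mkseq => /eqP -> /eqP /(congr1 (nth La ^~ j)).
by rewrite !nth_mkseq.
Qed.

Lemma growing_psi v : growing (fun n => psi (iprefix v n)).
Proof.
have pre n : prefix (rcons (psi (iprefix v n)) (v n)) (psi (iprefix v n.+1)).
  by rewrite /iprefix mkseqS psi_rcons prefix_pal_ext.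
move=> n; split; first exact: prefix_trans (prefix_rcons _ _) (pre n).
elim: n => // n IH; apply: leq_ltn_trans IH _.
by have := size_prefix (pre n); rewrite size_rcons.
Qed.

Lemma psi_inf_nth v n i : i < size (psi (iprefix v n)) ->
  psi_inf v i = nth La (psi (iprefix v n)) i.
Proof. exact: word_lim_nth (growing_psi v). Qed.

(** * Decoding the morphisms on infinite words *)

Lemma size_elem_gt x k c : k < size (elem x k c).
Proof. by rewrite size_cat size_nseq /= addnS ltnS leq_addr. Qed.

Lemma growing_subst x k t : growing (fun n => subst_word (elem x k) (iprefix t n)).
Proof.
move=> n; split.
  by rewrite /iprefix mkseqS -cats1 subst_word_cat prefix_prefix.
elim: n => // n IH; rewrite /iprefix mkseqS -cats1 subst_word_cat size_cat.
rewrite -addn1 leq_add // /subst_word /= cats0.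
exact: leq_trans (size_elem_gt x k _).
Qed.

Lemma morph_inf_nth x k t n i : i < size (subst_word (elem x k) (iprefix t n)) ->
  morph_inf (elem x k) t i = nth La (subst_word (elem x k) (iprefix t n)) i.
Proof. exact: word_lim_nth (growing_subst x k t). Qed.

Lemma morph_inf_shift x k t i :
  morph_inf (elem x k) t (size (elem x k (t 0)) + i) =
  morph_inf (elem x k) (shift 1 t) i.
Proof.
have [_ lt] := growing_subst x k (shift 1 t) i.+1.
have E : subst_word (elem x k) (iprefix t (1 + i.+1)) =
    elem x k (t 0) ++ subst_word (elem x k) (iprefix (shift 1 t) i.+1).
  by rewrite iprefixD subst_word_cat /subst_word /= cats0.
rewrite (morph_inf_nth lt) (@morph_inf_nth _ _ _ (1 + i.+1)) E.
  by rewrite nth_cat ltnNge leq_addr /= addKn.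
by rewrite size_cat ltn_add2l.
Qed.

(** Every block has its only [~~ x] at position k. If [t 0] is [~~ x], the first block has length
    k+1 and position 2k+1 is this [~~ x] in the second block. If [t 0] is [x], the first block is
    one longer and the position falls one earlier, on an [x]. *)
Lemma morph_inf_first x k t : morph_inf (elem x k) t k.*2.+1 = t 0.
Proof.
have nth_elem c j : j <= k -> nth La (elem x k c) j = if j == k then ~~ x else x.
  move=> le_jk; rewrite nth_cat size_nseq nth_nseq.
  by case: ltngtP le_jk => //= ->; rewrite subnn.
have E : subst_word (elem x k) (iprefix t 2) = elem x k (t 0) ++ elem x k (t 1).
  by rewrite /subst_word /= cats0.
have s0 : size (elem x k (t 0)) = k.+1 + (t 0 == x).
  by rewrite size_cat /= !size_nseq addnS.
have s1 := size_elem_gt x k (t 1).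
have lt : k.*2.+1 < size (elem x k (t 0) ++ elem x k (t 1)).
  by rewrite size_cat s0 -addnn -addSn -addnS leq_add // leq_addr.
rewrite (@morph_inf_nth _ _ _ 2) E // nth_cat s0.
have [->|ne] := eqVneq (t 0) x; last first.
  rewrite addn0 -addnn -addSn ltnNge leq_addr addKn /= nth_elem // eqxx.
  by move: ne; case: (t 0); case: (x).
(* For k = 0 the position is still in the first block, on its final [x]. *)
rewrite addn1 -addnn; case: k nth_elem {E s0 s1 lt} => [|k] nth_elem.
  by rewrite /elem /= eqxx.
by rewrite addnS -!addSn ltnNge leq_addr addKn /= nth_elem // ?ltn_eqF.
Qed.

Lemma morph_inf_inj x k : injective (morph_inf (elem x k)).
Proof.
move=> t t' eqF; apply/funext => n; elim: n t t' eqF => [|n IH] t t' eqF.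
  by rewrite -(morph_inf_first x k t) eqF morph_inf_first.
apply: (IH (shift 1 t) (shift 1 t')); apply/funext => i.
have t0 : t 0 = t' 0 by rewrite -(morph_inf_first x k t) eqF morph_inf_first.
by rewrite -!morph_inf_shift eqF t0.
Qed.

Lemma psi_inf_run x k v : (forall i, i < k -> v i = x) -> v k = ~~ x ->
  psi_inf v = morph_inf (elem x k) (psi_inf (shift k.+1 v)).
Proof.
move=> run stop; apply/funext => i; set v' := shift _ v.
(* Blocks are nonempty, so the images of the first [i.+1] letters cover position [i]. *)
have [_ lt] := growing_subst x k (psi_inf v') i.+1.
have [_ szp] := growing_psi v' i.+1.
have pE : iprefix (psi_inf v') i.+1 = take i.+1 (psi (iprefix v' i.+1)).
  apply: (@eq_from_nth _ La); rewrite size_mkseq ?size_takel // => j ltj.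
  by rewrite nth_mkseq // nth_take // (psi_inf_nth (leq_trans ltj szp)).
have vE : iprefix v (k.+1 + i.+1) = nseq k x ++ ~~ x :: iprefix v' i.+1.
  rewrite iprefixD -cat_rcons; congr (_ ++ _).
  rewrite /iprefix mkseqS stop; congr rcons.
  apply: (@eq_from_nth _ La); rewrite size_mkseq ?size_nseq // => j ltj.
  by rewrite nth_mkseq // nth_nseq ltj run.
have [r] := psi_run x k (iprefix v' i.+1); rewrite -vE.
rewrite -[in RHS](cat_take_drop i.+1 (psi (iprefix v' _))) -pE subst_word_cat.
rewrite -catA => psiE.
rewrite (morph_inf_nth lt) (@psi_inf_nth _ (k.+1 + i.+1)) psiE.
  by rewrite nth_cat lt.
by rewrite size_cat ltn_addr.
Qed.

Lemma psi_inf_first v : psi_inf v 0 = v 0.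
Proof.
have [_ sz] := growing_psi v 1.
by rewrite (psi_inf_nth sz) /iprefix /mkseq /= /psi /= pal_closureE; case: (v 0).
Qed.

Lemma psi_inf_inj : injective psi_inf.
Proof.
move=> v v' eqv; apply/funext => n; elim: n v v' eqv => [|n IH] v v' eqv.
  by rewrite -(psi_inf_first v) eqv psi_inf_first.
have v0 : v' 0 = v 0 by rewrite -(psi_inf_first v) eqv psi_inf_first.
(* Taking [~~ v 0] for [x] makes the initial run empty, so that [psi_inf_run] removes exactly the
   letter [v 0]. *)
apply: (IH (shift 1 v) (shift 1 v')); apply: (@morph_inf_inj (~~ v 0) 0).
by rewrite -[LHS]psi_inf_run ?negbK // -[RHS]psi_inf_run ?negbK.
Qed.

(** * The derivation *)

Definition both_infinitely_often (v : infword) : Prop :=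
  infinitely_often v La /\ infinitely_often v Lb.

Lemma both_infinitely_often_shift v p :
  both_infinitely_often v -> both_infinitely_often (shift p v).
Proof.
suff io c : infinitely_often v c -> infinitely_often (shift p v) c.
  by case=> ? ?; split; apply: io.
move=> H n; have [m le_m <-] := H (p + n).
exists (m - p); first by rewrite leq_subRL // (leq_trans _ le_m) ?leq_addr.
by rewrite /shift subnKC // (leq_trans _ le_m) ?leq_addr.
Qed.

Lemma first_run_ex v : both_infinitely_often v -> exists k, first_run v k.
Proof.
case=> ioa iob; have ex : exists k, v k != v 0.
  by case: (v 0); [have [m _ E] := ioa 0 | have [m _ E] := iob 0]; exists m; rewrite E.
case: (ex_minnP ex) => k vk min_k; exists k; split; last exact/eqP.
by move=> i; rewrite ltnNge; apply: contraNeq => /min_k.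
Qed.

Lemma first_run_unique v k k' : first_run v k -> first_run v k' -> k = k'.
Proof. by case=> r nk [r' nk']; case: (ltngtP k k') => // [/r'|/r]. Qed.

Lemma D_psi_inf v : both_infinitely_often v ->
  exists2 q, 0 < q & D (psi_inf v) = psi_inf (shift q v).
Proof.
move=> iov; have [k rk] := first_run_ex iov; exists k.+1 => //.
(* Injectivity of [psi_inf] makes the directive word unique, hence also the index. *)
have idx : sturm_index (psi_inf v) = k.
  apply: xget_unique => [|k' [v' [_ _ /psi_inf_inj <-]]].
    by case: (iov) => ? ?; exists v.
  by move=> rk'; apply: first_run_unique rk' rk.
have fE : (if psi_inf v 0 == La then mu (sturm_index (psi_inf v))
           else mu_hat (sturm_index (psi_inf v))) = elem (v 0) k.
  by rewrite idx psi_inf_first; apply/funext => c; case: (v 0); case: c.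
have vE : psi_inf v = morph_inf (elem (v 0) k) (psi_inf (shift k.+1 v)).
  case: rk => run /eqP stop; apply: psi_inf_run => //.
  by move: stop; case: (v k); case: (v 0).
rewrite /D fE; apply: get_unique => [|t]; first by rewrite /= -vE.
by rewrite /= [RHS]vE => /morph_inf_inj.
Qed.

(** Each derivation drops at least one letter of the directive word; the bound [n <= q] serves to
    separate iterates and to move past a preperiod. *)
Lemma iter_D_psi_inf v n : both_infinitely_often v ->
  exists2 q, n <= q & iter n D (psi_inf v) = psi_inf (shift q v).
Proof.
move=> iov; elim: n => [|n [q le_nq IH]]; first by exists 0.
have [q' q'_gt0 E] := D_psi_inf (both_infinitely_often_shift q iov).
exists (q + q'); first by rewrite -addn1 leq_add.
by rewrite iterS IH E; congr psi_inf; apply/funext => i; rewrite /shift addnA.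
Qed.

(** * Ultimate periodicity and stability *)

Lemma shift_eq_ultimately_periodic v p q : 0 < q ->
  shift (p + q) v = shift p v -> ultimately_periodic v.
Proof.
move=> q_gt0 E; exists (iprefix v p), (iprefix (shift p v) q); split.
  by case: q q_gt0 {E}.
apply/funext => n; rewrite /inf_cat /omega_power !size_mkseq.
case: ltnP => [ltn|le_pn]; first by rewrite nth_mkseq.
rewrite nth_mkseq ?ltn_mod // -{1}(subnKC le_pn) -/(shift p v _).
rewrite [in LHS](divn_eq (n - p) q).
elim: (_ %/ _) => [|j IH]; first by rewrite mul0n.
by rewrite mulSn -addnA {1}/shift addnA -/(shift (p + q) v _) E.
Qed.

Lemma ultimately_periodic_shift u z p q :
  let v := inf_cat u (omega_power z) in
  size u <= p -> size u <= q -> p = q %[mod size z] -> shift p v = shift q v.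
Proof.
move=> v le_p le_q eqpq; apply/funext => i; rewrite /v /shift /inf_cat /omega_power.
rewrite !ltnNge !(leq_trans _ (leq_addr _ _)) //=; congr nth.
apply/eqP; rewrite -(eqn_modDr (size u)) !subnK ?(leq_trans _ (leq_addr _ _)) //.
by rewrite eqn_modDr; apply/eqP.
Qed.

Theorem mainTheorem19 (s v : infword) (hsv : directive_word s v) :
  stable s <-> ultimately_periodic v.
Proof.
case: hsv => ioa iob ->; have iov : both_infinitely_often v by [].
split.
  case=> m [n []]; wlog lt_mn : m n / m < n => [H|ne_mn eqD].
    by case: (ltngtP m n) => // [|lt_nm ne /esym]; [apply: H|apply: H => // /esym].
  have [p _ Em] := iter_D_psi_inf m iov.
  (* The later iterate is derived from the earlier one, so its tail starts at [p + q] with [q] at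
     least [n - m], which is positive. *)
  have [q le_q En] := iter_D_psi_inf (n - m) (both_infinitely_often_shift p iov).
  apply: (@shift_eq_ultimately_periodic v p q).
    by rewrite (leq_trans _ le_q) // subn_gt0.
  apply: psi_inf_inj; rewrite -Em eqD -(subnK (ltnW lt_mn)) iterD Em En.
  by congr psi_inf; apply/funext => i; rewrite /shift addnA.
case=> u [z [z_neq0 vE]].
have /choice[p p_spec] : forall n, exists q,
    n <= q /\ iter n D (psi_inf v) = psi_inf (shift q v).
  by move=> n; have [q] := iter_D_psi_inf n iov; exists q.
have z_gt0 : 0 < size z by case: z z_neq0 {vE}.
(* Pigeonhole on starting positions modulo the period: starting from iterate [size u] puts all these
   tails beyond the preperiod [u], and two of the [(size z).+1] positions are congruent. *)
pose f (i : 'I_(size z).+1) : 'I_(size z) :=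
  Ordinal (ltn_pmod (p (size u + i)) z_gt0).
have /injectivePn[i [j ne_ij /(congr1 val) /= eqf]] : ~~ injectiveb f.
  by apply/injectiveP => /leq_card; rewrite !card_ord ltnn.
exists (size u + i), (size u + j); split.
  by move/addnI/val_inj/eqP; rewrite (negPf ne_ij).
have [le_i ->] := p_spec (size u + i); have [le_j ->] := p_spec (size u + j).
congr psi_inf; rewrite vE.
by apply: ultimately_periodic_shift eqf;
  [apply: leq_trans le_i | apply: leq_trans le_j]; apply: leq_addr.
Qed.
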